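(* Let $T\ge0$ and $\lambda>\omega$ be fixed. Let $\mathcal{L}_\lambda=\lambda^2(\lambda I-\mathcal{L})^{-1}-\lambda I$ be the Yosida approximation of the Koopman generator $\mathcal{L}$, and let $\mathcal{R}_{\lambda,T}h(x)=\int_0^Te^{-\lambda s}\mathcal{K}_sh(x)\,ds$ for $h\in\mathcal{C}(\Omega)$. Then, on $\operatorname{dom}(\mathcal{L})$, $$\big\|\lambda^2\mathcal{R}_{\lambda,T}-\lambda I-\mathcal{L}_\lambda\big\|\le\frac{C\lambda^2}{\lambda-\omega}e^{-\lambda T},$$ i.e. $\|\lambda^2\mathcal{R}_{\lambda,T}h-\lambda h-\mathcal{L}_\lambda h\|\le\frac{C\lambda^2}{\lambda-\omega}e^{-\lambda T}\|h\|$ for all $h\in\operatorname{dom}(\mathcal{L})$.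
   Context: $\Omega\subseteq\mathbb{R}^d$ is a pre-compact state space and $f$ is a locally Lipschitz vector field on $\Omega$; the flow $\phi(t,x)$ of $\dot x=f(x)$ is assumed to exist and stay in $\Omega$ for all $t\ge 0$, $x\in\Omega$. $\mathcal{C}(\Omega)$ is the Banach space of real-valued continuous functions on $\Omega$ with the uniform norm $\|h\|=\sup_{x\in\Omega}|h(x)|$. The Koopman operators $\mathcal{K}_t:\mathcal{C}(\Omega)\to\mathcal{C}(\Omega)$, $\mathcal{K}_th=h\circ\phi(t,\cdot)$, $t\ge0$, form a $\mathcal{C}_0$-semigroup, and $C\ge1$, $\omega\ge0$ are constants with $\|\mathcal{K}_t\|\le Ce^{\omega t}$ for all $t\ge0$. The generator is $\mathcal{L}h=\lim_{t\downarrow0}(\mathcal{K}_th-h)/t$, with $\operatorname{dom}(\mathcal{L})$ the set of $h\in\mathcal{C}(\Omega)$ for which the limit exists in $\mathcal{C}(\Omega)$. *)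

(* Defs.v *)
From HB Require Import structures.
From mathcomp Require Import all_boot all_order all_algebra.
From mathcomp Require Import all_classical all_reals all_analysis.

Set Implicit Arguments.
Unset Strict Implicit.
Unset Printing Implicit Defensive.

Import Order.TTheory GRing.Theory Num.Theory.
Import numFieldNormedType.Exports.

Local Open Scope classical_set_scope.
Local Open Scope ring_scope.

(** ** The normed space of bounded continuous functions

    On a precompact but non-compact space a continuous function may be
    unbounded, so boundedness is part of the definition; on a compact space it
    is automatic and [bcfun] is the space of all continuous functions. *)

Section bcfun.
Context {T : topologicalType} {R : realType}.

Definition bcontinuous : {pred T -> R} :=
  mem [set h : T -> R | continuous h /\ bounded_fun h].

Lemma bcontinuousP (h : T -> R) :
  reflect (continuous h /\ exists M, forall x, `|h x| <= M)
          (h \in bcontinuous).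
Proof.
apply: (iffP idP) => [/set_mem[hc hb]|[hc [M hM]]]; first split => //.
- by have [M [_ /(_ (M + 1))]] := hb; rewrite ltrDl ltr01 => /(_ isT) hM;
    exists (M + 1) => x; exact: hM.
- apply/mem_set; split => //; exists M; split; first exact: num_real.
  by move=> N MN x _; exact: le_trans (hM x) (ltW MN).
Qed.

Lemma bcontinuous_submod_closed : submod_closed bcontinuous.
Proof.
split=> [|a /= f g /bcontinuousP[fc [M fM]] /bcontinuousP[gc [N gN]]].
  apply/bcontinuousP; split; first by move=> x; exact: cvg_cst.
  by exists 0 => x; rewrite normr0.
apply/bcontinuousP; split.
  by move=> x; apply: cvgD; [apply: cvgZr; exact: fc|exact: gc].
exists (`|a| * M + N) => x.
by rewrite (le_trans (ler_normD _ _))// lerD// normrZ ler_wpM2l.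
Qed.

HB.instance Definition _ := GRing.isSubmodClosed.Build R (T -> R) bcontinuous
  bcontinuous_submod_closed.

Record bcfun := BCFun { bcfun_val :> T -> R; _ : bcfun_val \in bcontinuous }.

HB.instance Definition _ := [isSub for bcfun_val].
HB.instance Definition _ := [Choice of bcfun by <:].
HB.instance Definition _ := [SubChoice_isSubLmodule of bcfun by <:].

Lemma bcfun_bound (h : bcfun) : exists M, forall x, `|h x| <= M.
Proof. by have /bcontinuousP[] := valP h. Qed.

Lemma bcfun_continuous (h : bcfun) : continuous h.
Proof. by have /bcontinuousP[] := valP h. Qed.

Definition supnorm (h : bcfun) : R := sup [set `|h x| | x in setT].

Lemma supnorm_ub (h : bcfun) x : `|h x| <= supnorm h.
Proof.
have [M hM] := bcfun_bound h.
by apply: ub_le_sup; [exists M => _ [y _ <-]|exists x].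
Qed.

Lemma supnorm_le (h : bcfun) M :
  0 <= M -> (forall x, `|h x| <= M) -> supnorm h <= M.
Proof.
move=> M0 hM; rewrite /supnorm; set A := [set _ | _ in _].
have [->|/set0P A0] := eqVneq A set0; first by rewrite sup0.
by apply: ge_sup => // _ [y _ <-].
Qed.

Lemma supnorm_ge0 (h : bcfun) : 0 <= supnorm h.
Proof.
rewrite /supnorm; set A := [set _ | _ in _].
have [->|/set0P[_ [x _ _]]] := eqVneq A set0; first by rewrite sup0.
exact: le_trans (supnorm_ub h x).
Qed.

Lemma supnormD (f g : bcfun) : supnorm (f + g) <= supnorm f + supnorm g.
Proof.
apply: supnorm_le => [|x]; first by rewrite addr_ge0 ?supnorm_ge0.
by rewrite (le_trans (ler_normD _ _))// lerD// supnorm_ub.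
Qed.

Lemma supnormZ_le (a : R) (f : bcfun) : supnorm (a *: f) <= `|a| * supnorm f.
Proof.
apply: supnorm_le => [|x]; first by rewrite mulr_ge0 ?supnorm_ge0.
by rewrite normrM ler_wpM2l// supnorm_ub.
Qed.

Lemma supnormZ (a : R) (f : bcfun) : supnorm (a *: f) = `|a| * supnorm f.
Proof.
apply/eqP; rewrite eq_le supnormZ_le /=.
have [->|a0] := eqVneq a 0; first by rewrite normr0 mul0r supnorm_ge0.
rewrite -ler_pdivlMl ?normr_gt0// -normfV.
by rewrite -[in leLHS](scalerK a0 f) supnormZ_le.
Qed.

Lemma supnorm0_eq0 (f : bcfun) : supnorm f = 0 -> f = 0.
Proof.
move=> f0; apply/val_inj/funext => x /=.
by apply/eqP; rewrite -normr_le0 -f0 supnorm_ub.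
Qed.

HB.instance Definition _ :=
  Lmodule_isNormed.Build R bcfun supnormD supnormZ supnorm0_eq0.

Lemma bcfun_normE (h : bcfun) : `|h| = sup [set `|h x| | x in setT].
Proof. by []. Qed.

(** [to_bcfun g] is [g] itself when [g] is bounded and continuous; the value
    for other [g] is the meaningless default [0]. *)
Definition to_bcfun (g : T -> R) : bcfun := insubd 0 g.

Lemma to_bcfunE (g : T -> R) :
  continuous g -> (exists M, forall x, `|g x| <= M) -> to_bcfun g = g :> (T -> R).
Proof. by move=> gc gb; apply: insubdK; apply/bcontinuousP. Qed.

End bcfun.
Arguments bcfun : clear implicits.

(** ** Strongly continuous semigroups on a normed space *)

Section semigroup.
Context {R : realType} {X : normedModType R}.
Implicit Type K : R -> X -> X.

(** Operator families are indexed by all of [R]; only times [0 <= t] matter. *)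
Definition C0_semigroup K : Prop :=
  [/\ forall t, 0 <= t -> linear (K t) /\ continuous (K t),
      forall h, K 0 h = h,
      forall s t h, 0 <= s -> 0 <= t -> K (s + t) h = K s (K t h)
    & forall h, K t h @[t --> 0^'+] --> h].

Definition diff_quotient K (h : X) (t : R) : X := t^-1 *: (K t h - h).

Definition gen_dom K : set X :=
  [set h | cvg (diff_quotient K h t @[t --> 0^'+])].

Definition generator K (h : X) : X := lim (diff_quotient K h t @[t --> 0^'+]).

(** The inverse of [lambda I - L : dom L -> X], by default [0] outside of the
    range of that map. *)
Definition resolvent K (lambda : R) : X -> X :=
  'pinv_(fun=> 0) (gen_dom K) (fun g => lambda *: g - generator K g).

Definition yosida K (lambda : R) (h : X) : X :=
  lambda ^+ 2 *: resolvent K lambda h - lambda *: h.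

End semigroup.

(** ** Flows and Koopman operators *)

Section koopman.
Context {R : realType} {d : nat} {Omega : set 'rV[R]_d}.

(** [phi] solves [x' = f x] on [0, +oo) and stays in [Omega]; the derivative is
    taken within [0, +oo), hence is one-sided at [t = 0]. *)
Definition is_flow (f : 'rV[R]_d -> 'rV[R]_d) (phi : R -> Omega -> Omega) :
    Prop :=
  forall x : Omega, phi 0 x = x /\
    forall t, 0 <= t ->
      (s - t)^-1 *: (\val (phi s x) - \val (phi t x))
        @[s --> within [set s | 0 <= s] t^'] --> f (\val (phi t x)).

Definition is_koopman (phi : R -> Omega -> Omega)
    (K : R -> bcfun Omega R -> bcfun Omega R) : Prop :=
  forall t, 0 <= t -> forall h x, K t h x = h (phi t x).

Definition trunc_laplace (K : R -> bcfun Omega R -> bcfun Omega R)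
    (lambda T : R) (h : bcfun Omega R) : bcfun Omega R :=
  to_bcfun (fun x =>
    \int[lebesgue_measure]_(s in `[0, T]) (expR (- lambda * s) * K s h x)).

End koopman.

(* Main.v *)
Require Import Defs.
From HB Require Import structures.
From mathcomp Require Import all_boot all_order all_algebra.
From mathcomp Require Import all_classical all_reals all_analysis.
From mathcomp Require Import ring lra.

Import Order.TTheory GRing.Theory Num.Theory.
Import numFieldNormedType.Exports.

Local Open Scope classical_set_scope.
Local Open Scope ring_scope.

(** The Koopman operators are composition operators, so each [K t] with
    [0 <= t] is a contraction for the sup norm.  The estimate proved is the one for a contraction semigroup,
    [lambda * e^(- lambda T) * |h|], which is below the stated bound because
    [1 <= C] and [lambda - omega <= lambda].

    The resolvent at [h] is the Laplace transform
    [u = \int_0^oo e^(- lambda s) K_s h ds].  Since the integrals in the theorem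
    are scalar integrals taken at each point, [u] is obtained pointwise, as the
    limit of the truncated transforms [S_t h] ([laplace]); it is bounded and
    continuous because the convergence is uniform.  Translation of the
    integration variable ([laplaceD]) gives in the limit ([laplace_limit])

      [u = S_t h + e^(- lambda t) K_t u   for all t >= 0],

    and this single identity is used twice.  For small [t] it says
    [(K_t u - u) / t = ((e^(lambda t) - 1) / t) u - e^(lambda t) (S_t h / t)],
    whose limit is [lambda u - h]; thus [u] belongs to the domain of the
    generator [L] and [(lambda - L) u = h] ([laplace_resolvent]).  For [t = T]
    it says that the error [lambda^2 S_T h - lambda h - L_lambda h] is
    [- lambda^2 e^(- lambda T) K_T u].

    The dissipativity estimate [lambda |g| <= |lambda g - L g|]
    ([generator_dissipative]) does the rest: it makes [lambda - L] injective, so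
    that the resolvent of [h] is [u], and it gives [|u| <= |h| / lambda]. *)

(** * Integrals of continuous functions on the real line *)

Section real_integrals.
Context {R : realType}.
Local Notation mu := (@lebesgue_measure R).

Lemma continuous_integrable_itv (g : R -> R) (a b : R) :
  continuous g -> mu.-integrable `[a, b] (EFin \o g).
Proof.
move=> gc; apply: continuous_compact_integrable; first exact: segment_compact.
exact: continuous_subspaceT.
Qed.

Lemma le_norm_Rintegral (g : R -> R) (t M : R) : 0 <= t -> continuous g ->
  (forall s, 0 <= s <= t -> `|g s| <= M) ->
  `|\int[mu]_(s in `[0, t]) g s| <= M * t.
Proof.
move=> t0 gc gM; have ig := @continuous_integrable_itv g 0 t gc.
apply: (le_trans (le_normr_Rintegral _ ig)) => //.
have -> : M * t = \int[mu]_(s in `[0, t]) M.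
  rewrite Rintegral_cst//= lebesgue_measure_itv/= lte_fin.
  by case: ltgtP t0 => //= [|<-] _; rewrite ?subr0// ?mulr0.
apply: le_Rintegral => //.
- apply: continuous_integrable_itv => x.
  by apply: continuous_comp; [exact: gc|exact: norm_continuous].
- by apply: continuous_integrable_itv => x; exact: cvg_cst.
Qed.

Lemma Rintegral_shift (g : R -> R) (s t : R) : 0 <= s -> continuous g ->
  \int[mu]_(r in `[t, s + t]) g r = \int[mu]_(r in `[0, s]) g (r + t).
Proof.
move=> s0 gc; pose F (r : R) := r + t.
have dF : (F^`())%classic = cst 1.
  by apply/funext => r; rewrite /F derive1E deriveD// derive_id derive_cst addr0.
have Fc : continuous F by move=> r; apply: cvgD; [exact: cvg_id|exact: cvg_cst].
have := @integration_by_substitution_increasing _ F g 0 s s0.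
rewrite (_ : F 0 = t) ?dF; last exact: add0r.
rewrite (_ : F s = s + t)// => H.
rewrite /Rintegral H //.
- congr fine; apply: eq_integral => r _ /=.
  by rewrite fctE /= mulr1.
- by move=> x y _ _; rewrite ltrD2r.
- by move=> r _; exact: cvg_cst.
- exact: is_cvg_cst.
- exact: is_cvg_cst.
- split.
  + by move=> r _; exact: ex_derive.
  + by apply: cvg_at_right_filter; exact: Fc.
  + by apply: cvg_at_left_filter; exact: Fc.
- exact: continuous_subspaceT.
Qed.

Lemma expR_scale_continuous (c : R) : continuous (fun s : R => expR (c * s)).
Proof.
move=> s; apply: continuous_comp; last exact: continuous_expR.
exact: mulrl_continuous.
Qed.

Lemma Rintegral_expRN_le (lambda t : R) : 0 < lambda -> 0 <= t ->
  \int[mu]_(s in `[0, t]) expR (- lambda * s) <= lambda^-1.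
Proof.
move=> l0; rewrite le_eqVlt => /predU1P[<-|t0].
  by rewrite set_itv1 Rintegral_set1 invr_ge0 ltW.
have ce := expR_scale_continuous (- lambda).
rewrite -[leRHS]mulr1 ler_pdivlMl//.
rewrite -RintegralZl//; last exact: continuous_integrable_itv.
have cf : continuous (fun s : R => lambda * expR (- lambda * s)).
  by move=> s; apply: cvgM; [exact: cvg_cst|exact: ce].
pose F (s : R) := - expR (- lambda * s).
have cF : continuous F by move=> s; apply: cvgN; exact: ce.
rewrite /Rintegral (@continuous_FTC2 _ _ F _ _ t0).
- by rewrite /F mulr0 expR0 -EFinB/= opprK -lerBrDr subrr oppr_le0 expR_ge0.
- exact: continuous_subspaceT.
- split.
  + by move=> s _; exact: ex_derive.
  + by apply: cvg_at_right_filter; exact: cF.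
  + by apply: cvg_at_left_filter; exact: cF.
- move=> s _; rewrite derive1E derive_val.
  by rewrite /GRing.scale/= mulr1; ring.
Qed.

(** The time [c / (e * lambda)] works because [e^x >= 1 + x]. *)
Lemma expR_decay (lambda c e : R) : 0 < lambda -> 0 <= c -> 0 < e ->
  exists2 s, 0 <= s & expR (- lambda * s) * c <= e.
Proof.
move=> l0 c0 e0; exists (c / (e * lambda)).
  by rewrite divr_ge0// mulr_ge0// ltW.
rewrite mulNr expRN mulrC ler_pdivrMr ?expR_gt0//.
have := expR_ge1Dx (lambda * (c / (e * lambda))).
rewrite (_ : lambda * _ = c / e); last by field; rewrite !gt_eqF.
rewrite -(ler_pM2l e0); apply: le_trans.
by rewrite mulrDr mulr1 mulrC divfK ?gt_eqF// lerDr ltW.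
Qed.

Lemma expR_diff_quotient (lambda : R) :
  t^-1 * (expR (lambda * t) - 1) @[t --> 0^'+] --> lambda.
Proof.
pose f (t : R) := expR (lambda * t).
have df : derivable f 0 1 by exact: ex_derive.
have f'E : 'D_1 f 0 = lambda.
  by rewrite derive_val mulr0 expR0 mul1r -[_%:A]/(_ * 1) mulr1.
apply: cvg_dnbhs_at_right.
rewrite -[X in _ --> X]f'E.
apply: cvg_trans df; apply: near_eq_cvg; apply: nearW => t /=.
by rewrite /f -[t *: 1]/(t * 1) mulr1 addr0 mulr0 expR0.
Qed.

End real_integrals.

(** * Integrals of curves of bounded continuous functions *)

Section integral_bcfun.
Context {T : topologicalType} {R : realType}.
Implicit Types (G : R -> bcfun T R) (t : R).
Local Notation mu := (@lebesgue_measure R).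

Lemma pointwise_le_norm (h : bcfun T R) x : `|h x| <= `|h|.
Proof. exact: supnorm_ub. Qed.

Lemma pointwise_continuous G x : continuous G -> continuous (fun s => G s x).
Proof.
move=> Gc s; apply/cvgrPdist_le => e e0.
have /cvgrPdist_le/(_ e e0) := Gc s.
apply: filterS => r; apply: le_trans.
exact: (pointwise_le_norm (G s - G r)).
Qed.

Lemma Rintegral_bcfun_bounded G t : 0 <= t -> continuous G ->
  exists M, forall x, `|\int[mu]_(s in `[0, t]) G s x| <= M.
Proof.
move=> t0 Gc.
have nc : continuous (fun s => `|G s|).
  by move=> s; apply: continuous_comp; [exact: Gc|exact: norm_continuous].
have [c _ cM] := EVT_max t0 (continuous_subspaceT nc).
exists (`|G c| * t) => x; apply: le_norm_Rintegral => //.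
  exact: pointwise_continuous.
move=> s st; apply: le_trans (cM s _); last by rewrite in_itv.
exact: pointwise_le_norm.
Qed.

(** By compactness of [[0, t]], [G s x0 - G s x] is small uniformly in [s] once
    [x] is close to [x0]: near each [s] the curve moves little in sup norm, and
    the single function [G s] is continuous at [x0]. *)
Lemma Rintegral_bcfun_continuous G t : 0 <= t -> continuous G ->
  continuous (fun x => \int[mu]_(s in `[0, t]) G s x).
Proof.
move=> t0 Gc x0; apply/cvgrPdist_le => e e0.
have d0 : 0 < e / (t + 1) by rewrite divr_gt0// ltr_wpDl.
set d := e / (t + 1) in d0.
have /compact_near_coveringP/near_covering_withinP cov :
  compact (`[0, t] : set R) by exact: segment_compact.
have : \forall x \near x0, `[0, t] `<=` (fun s => `|G s x0 - G s x| <= d).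
  apply: (cov _ _ (fun x s => `|G s x0 - G s x| <= d)) => s _.
  have d3 : 0 < d / 3 by rewrite divr_gt0.
  have /cvgrPdist_le/(_ _ d3) Gs := Gc s.
  have /cvgrPdist_le/(_ _ d3) Gx := @bcfun_continuous _ _ (G s) x0.
  exists ([set r | `|G s - G r| <= d / 3],
          [set x | `|G s x0 - G s x| <= d / 3]) => //.
  move=> [r x] [/= H1 H2] _.
  have H3 y : `|G s y - G r y| <= d / 3.
    by apply: le_trans H1; exact: (pointwise_le_norm (G s - G r)).
  have -> : G r x0 - G r x =
      (G r x0 - G s x0) + (G s x0 - G s x) + (G s x - G r x).
    by ring.
  have -> : d = d / 3 + d / 3 + d / 3 by lra.
  rewrite (le_trans (ler_normD _ _))// lerD// (le_trans (ler_normD _ _))//.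
  by rewrite lerD// distrC.
apply: filterS => x Hx.
rewrite -RintegralB//;
  try by apply: continuous_integrable_itv; exact: pointwise_continuous.
have -> : e = d * (t + 1).
  by rewrite mulfVK// gt_eqF// ltr_wpDl.
apply: (@le_trans _ _ (d * t)); last by rewrite ler_pM2l// lerDl.
apply: (@le_norm_Rintegral _ (fun s => G s x0 - G s x)) => //.
by move=> s; apply: cvgB; exact: pointwise_continuous.
Qed.

(** Taken at each point of [T], which makes sense of the integral of a curve of
    functions without completeness of [bcfun T R]; the default value is 0 when
    the result is not bounded and continuous. *)
Definition bcint G t : bcfun T R :=
  to_bcfun (fun x => \int[mu]_(s in `[0, t]) G s x).

Lemma bcintE G t x : 0 <= t -> continuous G ->
  bcint G t x = \int[mu]_(s in `[0, t]) G s x.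
Proof.
move=> t0 Gc; rewrite /bcint to_bcfunE//.
  exact: Rintegral_bcfun_continuous.
exact: Rintegral_bcfun_bounded.
Qed.

(** At each point, [G 0 - bcint G t / t] is the mean of [G 0 - G s] over
    [[0, t]], so it is at most the largest sup norm of [G 0 - G s] there. *)
Lemma bcint_diff0 G : continuous G ->
  t^-1 *: bcint G t @[t --> 0^'+] --> G 0.
Proof.
move=> Gc; apply/cvgrPdist_le => e e0.
have /cvgrPdist_le/(_ _ e0) := Gc 0.
case=> /= d d0 Hd; exists d => //= t /= Ht t0.
apply: supnorm_le => [|x]; first exact: ltW.
have -> : (G 0 - t^-1 *: bcint G t) x = G 0 x - t^-1 * bcint G t x by [].
rewrite bcintE ?(ltW t0)//.
have -> : G 0 x = t^-1 * \int[mu]_(s in `[0, t]) (G 0 x).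
  rewrite Rintegral_cst//= lebesgue_measure_itv/= lte_fin t0 -EFinB subr0/=.
  by rewrite mulrCA mulVf ?mulr1// gt_eqF.
rewrite -mulrBr -RintegralB//;
  [|by apply: continuous_integrable_itv => ?; exact: cvg_cst
   |by apply: continuous_integrable_itv; exact: pointwise_continuous].
rewrite normrM gtr0_norm ?invr_gt0// mulrC ler_pdivrMr//.
apply: (@le_norm_Rintegral _ (fun s => G 0 x - G s x)); first exact: ltW.
  by move=> s; apply: cvgB; [exact: cvg_cst|exact: pointwise_continuous].
move=> s /andP[s0 st]; apply: (@le_trans _ _ `|G 0 - G s|).
  exact: (pointwise_le_norm (G 0 - G s)).
apply: Hd => /=; rewrite sub0r normrN ger0_norm//.
apply: le_lt_trans st _.
by move: Ht; rewrite sub0r normrN gtr0_norm.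
Qed.

End integral_bcfun.

(** * Contraction semigroups *)

Lemma subrACA (V : zmodType) (a b c d : V) : a - b - (c - d) = a - c - (b - d).
Proof. by rewrite !opprB addrACA [RHS]addrACA (addrC (- b)). Qed.

Section contraction_semigroup.
Context {R : realType} {X : normedModType R}.
Variable K : R -> X -> X.
Hypothesis K_semigroup : C0_semigroup K.
Hypothesis K_contraction : forall t h, 0 <= t -> `|K t h| <= `|h|.

Lemma semigroupB t g h : 0 <= t -> K t (g - h) = K t g - K t h.
Proof.
move=> t0; have [/(_ t t0)[Kl _] _ _ _] := K_semigroup.
have := Kl (-1) h g.
by rewrite !scaleN1r (addrC (- h)) (addrC (- K t h)).
Qed.

Lemma orbit_dist s t h : 0 <= s -> s <= t ->
  `|K s h - K t h| <= `|h - K (t - s) h|.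
Proof.
move=> s0 st; have [_ _ KD _] := K_semigroup.
have ts0 : 0 <= t - s by rewrite subr_ge0.
have -> : K t h = K s (K (t - s) h) by rewrite -KD// subrKC.
rewrite -semigroupB//.
exact: K_contraction.
Qed.

(** The absolute value extends the orbit to a continuous curve on the whole
    line, which spares one-sided continuity conditions in the integrals. *)
Lemma orbit_continuous h : continuous (fun s : R => K `|s| h).
Proof.
move=> s; have [_ _ _ K0] := K_semigroup.
apply/cvgrPdist_le => e e0.
have [d /= d0 Hd] := (cvgrPdist_le _ _).1 (K0 h) e e0.
have Hd' r : 0 <= r < d -> `|h - K r h| <= e.
  move=> /andP[]; rewrite le_eqVlt => /predU1P[<- _|r0 rd].
    by have [_ -> _ _] := K_semigroup; rewrite subrr normr0 ltW.
  by apply: Hd => //=; rewrite sub0r normrN gtr0_norm.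
exists d => //= r rd.
have {}rd : `| `|s| - `|r| | < d by apply: le_lt_trans rd; exact: ler_dist_dist.
have [sr|/ltW rs] := leP `|s| `|r|.
  apply: le_trans (orbit_dist _ _ _ _ _) _ => //; apply: Hd'.
  by rewrite subr_ge0 sr/=; apply: le_lt_trans rd; rewrite distrC ler_norm.
rewrite distrC; apply: le_trans (orbit_dist _ _ _ _ _) _ => //; apply: Hd'.
by rewrite subr_ge0 rs/=; apply: le_lt_trans rd; rewrite ler_norm.
Qed.

Lemma generatorE g l : diff_quotient K g t @[t --> 0^'+] --> l ->
  gen_dom K g /\ generator K g = l.
Proof.
move=> gl; split; first by apply/cvg_ex; exists l.
by apply: cvg_lim => //; exact: norm_hausdorff.
Qed.

(** If [q] is the difference quotient of [g] at time [t], then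
    [t (lambda g - q) = (1 + t lambda) g - K t g], of norm at least
    [(1 + t lambda) |g| - |g|] by contraction; divide by [t] and let [t] tend
    to 0. *)
Lemma generator_dissipative (lambda : R) g : 0 < lambda -> gen_dom K g ->
  lambda * `|g| <= `|lambda *: g - generator K g|.
Proof.
move=> l0 gK.
have : `|lambda *: g - diff_quotient K g t| @[t --> 0^'+] -->
       `|lambda *: g - generator K g|.
  by apply: cvg_norm; apply: cvgB => //; exact: cvg_cst.
move=> /cvgr_to_ge; apply.
near=> t.
have t0 : 0 < t by [].
rewrite -(ler_pM2l t0) -{2}(gtr0_norm t0) -normrZ.
have -> : t *: (lambda *: g - diff_quotient K g t) =
    (1 + t * lambda) *: g - K t g.
  rewrite scalerBr scalerA /diff_quotient scalerA divff ?gt_eqF// scale1r.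
  by rewrite scalerDl scale1r opprB addrA [in RHS](addrC g).
apply: le_trans (lerB_dist _ _).
rewrite normrZ gtr0_norm ?addr_gt0 ?mulr_gt0// mulrDl mul1r mulrA.
by rewrite -addrA addrCA lerDl subr_ge0 K_contraction// ltW.
Unshelve. all: by end_near.
Qed.

Lemma generatorB g h : gen_dom K g -> gen_dom K h ->
  gen_dom K (g - h) /\ generator K (g - h) = generator K g - generator K h.
Proof.
move=> gK hK; apply: generatorE.
have : diff_quotient K g t - diff_quotient K h t @[t --> 0^'+] -->
    generator K g - generator K h by exact: cvgB.
apply: cvg_trans; apply: near_eq_cvg; near=> t.
have t0 : 0 < t by [].
rewrite /diff_quotient -scalerBr semigroupB ?ltW//; congr (_ *: _).
by rewrite subrACA.
Unshelve. all: by end_near.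
Qed.

Lemma resolventE (lambda : R) g : 0 < lambda -> gen_dom K g ->
  resolvent K lambda (lambda *: g - generator K g) = g.
Proof.
move=> l0 gK; rewrite /resolvent.
apply: (@pinvKV _ _ (fun=> 0) (gen_dom K)
  (fun g => lambda *: g - generator K g)).
  move=> g1 g2 /set_mem g1K /set_mem g2K /eqP; rewrite -subr_eq0 => /eqP e.
  have [dK dE] := generatorB g1 g2 g1K g2K.
  have := generator_dissipative lambda _ l0 dK.
  rewrite dE scalerBr subrACA e normr0 pmulr_rle0// normr_le0 subr_eq0.
  by move/eqP.
exact/mem_set.
Qed.

End contraction_semigroup.

(** * Laplace transform of a semigroup of composition operators *)

Section composition_semigroup.
Context {T : topologicalType} {R : realType}.
Variables (phi : R -> T -> T) (K : R -> bcfun T R -> bcfun T R).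
Hypothesis K_comp : forall t, 0 <= t -> forall h x, K t h x = h (phi t x).
Hypothesis K_semigroup : C0_semigroup K.
Variable lambda : R.
Hypothesis lambda_gt0 : 0 < lambda.
Local Notation mu := (@lebesgue_measure R).

Lemma composition_contraction t h : 0 <= t -> `|K t h| <= `|h|.
Proof.
move=> t0; apply: supnorm_le => [|x]; first exact: normr_ge0.
by rewrite K_comp// pointwise_le_norm.
Qed.

Definition discounted (h : bcfun T R) (s : R) : bcfun T R :=
  expR (- lambda * s) *: K `|s| h.

Lemma discounted_continuous h : continuous (discounted h).
Proof.
move=> s; apply: cvgZ; first exact: expR_scale_continuous.
exact: (orbit_continuous _ K_semigroup composition_contraction).
Qed.

Lemma discountedE h s x : 0 <= s ->
  discounted h s x = expR (- lambda * s) * h (phi s x).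
Proof.
move=> s0.
have -> : discounted h s x = expR (- lambda * s) * K `|s| h x by [].
by rewrite K_comp// ger0_norm.
Qed.

Let discounted_eval_continuous h x : continuous (fun s => discounted h s x).
Proof. by apply: pointwise_continuous; exact: discounted_continuous. Qed.

Definition laplace (h : bcfun T R) (t : R) : bcfun T R :=
  bcint (discounted h) t.

Lemma laplaceE h t x : 0 <= t ->
  laplace h t x = \int[mu]_(s in `[0, t]) discounted h s x.
Proof. by move=> t0; apply: bcintE => //; exact: discounted_continuous. Qed.

Lemma laplace_bound h t x : 0 <= t -> `|laplace h t x| <= lambda^-1 * `|h|.
Proof.
move=> t0; rewrite laplaceE//.
have ic := continuous_integrable_itv _ 0 t (discounted_eval_continuous h x).
apply: le_trans (le_normr_Rintegral _ ic) _ => //.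
have ie := continuous_integrable_itv _ 0 t (expR_scale_continuous (- lambda)).
apply: (@le_trans _ _ (\int[mu]_(s in `[0, t]) (expR (- lambda * s) * `|h|))).
  apply: le_Rintegral => //.
  - apply: (continuous_integrable_itv (fun s => `|discounted h s x|)) => s.
    by apply: cvg_norm; exact: discounted_eval_continuous.
  - apply: continuous_integrable_itv => s; apply: cvgM; last exact: cvg_cst.
    exact: expR_scale_continuous.
  - move=> s s0t; have {s0t} s0 : 0 <= s.
      by move: s0t; rewrite /= in_itv => /andP[].
    rewrite discountedE// normrM ger0_norm ?expR_ge0//.
    by rewrite ler_wpM2l ?expR_ge0// pointwise_le_norm.
by rewrite RintegralZr// ler_wpM2r// Rintegral_expRN_le.
Qed.

(** The part of the integral over [[t, s + t]] is translated to [[0, s]], where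
    the semigroup law turns [K (r + t) h x] into [K r h (phi t x)]. *)
Lemma laplaceD h s t x : 0 <= s -> 0 <= t ->
  laplace h (s + t) x =
    laplace h t x + expR (- lambda * t) * laplace h s (phi t x).
Proof.
move=> s0 t0; rewrite !laplaceE// ?addr_ge0//.
have ic a b := continuous_integrable_itv _ a b (discounted_eval_continuous h x).
apply/eqP; rewrite [eqbRHS]addrC -subr_eq; apply/eqP.
rewrite (Rintegral_itvB (ic 0 (s + t))) ?bnd_simp ?lerDr//.
rewrite Rintegral_itv_obnd_cbnd; last first.
  apply: integrableS (ic t (s + t)) => //.
  by apply: subset_itvr; rewrite bnd_simp.
rewrite Rintegral_shift//.
rewrite -RintegralZl//; last exact: continuous_integrable_itv.
apply: eq_Rintegral => r rs; have {rs} r0 : 0 <= r.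
  by move: rs; rewrite inE/= in_itv => /andP[].
rewrite !discountedE ?addr_ge0// mulrA -expRD -mulrDr (addrC t); congr (_ * _).
rewrite -!K_comp// ?addr_ge0//.
have [_ _ KD _] := K_semigroup.
by rewrite addrC KD// K_comp.
Qed.

(** By [laplaceD] and [laplace_bound], [laplace h s x] differs from
    [laplace h t x] by at most [e^(- lambda t) |h| / lambda] for [t <= s], so the
    limit as [s] tends to infinity exists and is uniform in [x]; the identity is
    the limit of [laplaceD]. *)
Lemma laplace_limit h : exists u : bcfun T R, forall t, 0 <= t ->
  u = laplace h t + expR (- lambda * t) *: K t u.
Proof.
set c := lambda^-1 * `|h|.
have c0 : 0 <= c by rewrite mulr_ge0// invr_ge0 ltW.
have tail s t x : 0 <= t -> t <= s ->
    `|laplace h t x - laplace h s x| <= expR (- lambda * t) * c.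
  move=> t0 ts; have st : 0 <= s - t by rewrite subr_ge0.
  have -> : laplace h s x = laplace h (s - t + t) x by rewrite subrK.
  rewrite laplaceD// opprD addNKr normrN normrM.
  by rewrite ger0_norm ?expR_ge0// ler_wpM2l ?expR_ge0// laplace_bound.
have lapc x : cvg (laplace h s x @[s --> +oo]).
  apply/cauchy_cvgP; apply: cauchy_exP => e e0.
  have [t t0 et] := expR_decay _ _ _ lambda_gt0 c0 (divr_gt0 e0 (ltr0Sn _ 1)).
  exists (laplace h t x).
  (* the filter of the limit is an image filter; go back to the variable s *)
  change (\forall s \near +oo, ball (laplace h t x) e (laplace h s x)).
  near=> s.
  rewrite -ball_normE /=; apply: (le_lt_trans (tail s t x t0 _)); first by [].
  by rewrite (le_lt_trans et)// ltr_pdivrMr// ltr_pMr// ltr1n.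
pose U x := lim (laplace h s x @[s --> +oo]).
have Utail t x : 0 <= t -> `|laplace h t x - U x| <= expR (- lambda * t) * c.
  move=> t0.
  have : `|laplace h t x - laplace h s x| @[s --> +oo] --> `|laplace h t x - U x|.
    by apply: cvg_norm; apply: cvgB; [exact: cvg_cst|exact: lapc].
  move=> /cvgr_to_le; apply; near=> s; exact: tail.
have Uc : continuous U.
  move=> x0; apply/cvgrPdist_le => e e0.
  have e3 : 0 < e / 3 by rewrite divr_gt0.
  have [t t0 et] := expR_decay _ _ _ lambda_gt0 c0 e3.
  have /cvgrPdist_le/(_ _ e3) := @bcfun_continuous _ _ (laplace h t) x0.
  apply: filterS => x Hx.
  have -> : U x0 - U x = (U x0 - laplace h t x0) +
    (laplace h t x0 - laplace h t x) + (laplace h t x - U x) by ring.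
  have -> : e = e / 3 + e / 3 + e / 3 by lra.
  rewrite (le_trans (ler_normD _ _))// lerD ?(le_trans (Utail _ _ _))//.
  rewrite (le_trans (ler_normD _ _))// lerD//.
  by rewrite distrC (le_trans (Utail _ _ _)).
have Ub : exists M, forall x, `|U x| <= M.
  exists (c + c) => x; rewrite -(subrK (laplace h 0 x) (U x)).
  rewrite (le_trans (ler_normD _ _))// lerD ?laplace_bound// distrC.
  by rewrite (le_trans (Utail _ _ _))// mulr0 expR0 mul1r.
exists (to_bcfun U) => t t0; apply/val_inj/funext => x /=.
transitivity (laplace h t x + expR (- lambda * t) * K t (to_bcfun U) x);
  last by [].
rewrite K_comp// to_bcfunE//.
apply/eqP; rewrite -subr_eq0 -normr_le0; apply/ler_addgt0Pl => e e0.
rewrite addr0.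
have [s s0 es] := expR_decay _ _ _ lambda_gt0 c0 (divr_gt0 e0 (ltr0Sn _ 1)).
have -> : U x - (laplace h t x + expR (- lambda * t) * U (phi t x)) =
  (U x - laplace h (s + t) x) +
  expR (- lambda * t) * (laplace h s (phi t x) - U (phi t x)).
  by rewrite laplaceD//; ring.
have -> : e = e / 2 + e / 2 by lra.
rewrite (le_trans (ler_normD _ _))// lerD//.
  rewrite distrC (le_trans (Utail _ _ _)) ?addr_ge0// (le_trans _ es)//.
  by rewrite ler_wpM2r// ler_expR !mulNr lerN2 ler_pM2l// lerDl.
rewrite normrM ger0_norm ?expR_ge0// (le_trans _ es)//.
rewrite (le_trans (ler_wpM2l (expR_ge0 _) (Utail _ _ _)))//.
rewrite ler_piMl//; first by rewrite mulr_ge0// expR_ge0.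
by rewrite -expR0 ler_expR mulNr oppr_le0 mulr_ge0// ltW.
Unshelve. all: by end_near.
Qed.

(** Solving the identity for [K t u] gives
    [K t u = e^(lambda t) (u - laplace h t)], whose right derivative at 0 is
    [lambda u - h] because [laplace h t / t] tends to [h]. *)
Lemma laplace_resolvent h u :
  (forall t, 0 <= t -> u = laplace h t + expR (- lambda * t) *: K t u) ->
  gen_dom K u /\ generator K u = lambda *: u - h.
Proof.
move=> uE; apply: generatorE.
have d0 : discounted h 0 = h.
  have [_ K0 _ _] := K_semigroup.
  by rewrite /discounted normr0 K0 mulr0 expR0 scale1r.
have ce : expR (lambda * t) @[t --> 0^'+] --> (1 : R).
  apply: cvg_at_right_filter.
  have := expR_scale_continuous lambda 0.
  by rewrite /continuous_at mulr0 expR0.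
have dl : t^-1 *: laplace h t @[t --> 0^'+] --> h.
  rewrite -[X in _ --> X]d0; apply: bcint_diff0; exact: discounted_continuous.
have : (t^-1 * (expR (lambda * t) - 1)) *: u -
    expR (lambda * t) *: (t^-1 *: laplace h t) @[t --> 0^'+] --> lambda *: u - h.
  apply: cvgB.
    by apply: cvgZ; [exact: expR_diff_quotient|exact: cvg_cst].
  by rewrite -[X in _ --> X]scale1r; exact: cvgZ.
apply: cvg_trans; apply: near_eq_cvg; near=> t.
have t0 : 0 <= t by [].
have Ku : K t u = expR (lambda * t) *: (u - laplace h t).
  rewrite {2}(uE t t0) [laplace h t + _]addrC addrK scalerA -expRD mulNr subrr.
  by rewrite expR0 scale1r.
rewrite /diff_quotient Ku -(scalerA t^-1) [in X in _ - X]scalerA.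
rewrite (mulrC _ t^-1) -(scalerA t^-1) -scalerBr; congr (_ *: _).
by rewrite scalerBl scale1r scalerBr addrAC.
Unshelve. all: by end_near.
Qed.

End composition_semigroup.

(** * The error of the truncated Laplace transform *)

Theorem mainTheorem3 (R : realType) (d : nat) (Omega : set 'rV[R]_d)
    (f : 'rV[R]_d -> 'rV[R]_d) (phi : R -> Omega -> Omega)
    (K : R -> bcfun Omega R -> bcfun Omega R) (C omega T lambda : R)
    (Omega_precompact : precompact Omega)
    (f_lipschitz : [locally [lipschitz f x | x in Omega]])
    (phi_flow : is_flow f phi)
    (K_koopman : is_koopman phi K)
    (K_semigroup : C0_semigroup K)
    (C_ge1 : 1 <= C) (omega_ge0 : 0 <= omega)
    (K_bound : forall t, 0 <= t ->
       forall h, `|K t h| <= C * expR (omega * t) * `|h|)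
    (T_ge0 : 0 <= T) (lambda_gt : omega < lambda) :
  forall h, gen_dom K h ->
    `| lambda ^+ 2 *: trunc_laplace K lambda T h - lambda *: h
       - yosida K lambda h |
    <= C * lambda ^+ 2 / (lambda - omega) * expR (- lambda * T) * `|h|.
Proof.
move=> h _; have l0 : 0 < lambda by exact: le_lt_trans lambda_gt.
have l0_ge0 : 0 <= lambda by exact: ltW.
have lE : trunc_laplace K lambda T h = laplace K lambda h T.
  congr to_bcfun; apply/funext => x; apply: eq_Rintegral => s.
  rewrite inE /= in_itv => /andP[s0 _].
  by rewrite ger0_norm.
have Kc := composition_contraction phi K K_koopman.
have [u uE] := laplace_limit phi K K_koopman K_semigroup _ l0 h.
have [uK Lu] := laplace_resolvent phi K K_koopman K_semigroup _ h u uE.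
have Ru : resolvent K lambda h = u.
  rewrite -[RHS](resolventE K K_semigroup Kc lambda u l0 uK).
  by congr resolvent; rewrite Lu subKr.
have u_le : lambda * `|u| <= `|h|.
  have := generator_dissipative K Kc lambda u l0 uK.
  by rewrite Lu subKr.
have -> : lambda ^+ 2 *: trunc_laplace K lambda T h - lambda *: h
    - yosida K lambda h = - (lambda ^+ 2 * expR (- lambda * T)) *: K T u.
  rewrite lE /yosida Ru {1}(uE T T_ge0) scalerDr scalerA scaleNr.
  by rewrite opprB addrA subrK opprD addrA subrr sub0r.
rewrite normrZ normrN ger0_norm ?mulr_ge0 ?sqr_ge0 ?expR_ge0//.
rewrite [leLHS]mulrAC [leRHS]mulrAC ler_wpM2r ?expR_ge0//.
(* With the factor e^(- lambda T) removed, lambda |h| is the bound for a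
   contraction semigroup; it separates the two sides. *)
apply: (@le_trans _ _ (lambda * `|h|)).
  rewrite expr2 -mulrA ler_wpM2l// (le_trans _ u_le)//.
  by rewrite ler_wpM2l// Kc.
rewrite ler_wpM2r// ler_pdivlMr ?subr_gt0// expr2 mulrA.
rewrite mulrC ler_pM2r//.
apply: (@le_trans _ _ lambda); first by rewrite gerBl.
by rewrite ler_peMl.
Qed.
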